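(* For every fixed $\beta\in[1/3,1/2)$, there is an infinite sequence of integers $n\to\infty$ and bipartite graphs $G$ on $n$ vertices with $$e(G)=\Theta_\beta(n^{2-\beta}),\qquad \rho(G):=\frac{e(G)}{n^2}=\Theta_\beta(n^{-\beta}),$$ such that every internally strongly $C_6$-connected subgraph $H\subseteq G$ satisfies $$e(H)=O_\beta\left(\frac{\rho(G)^3n^2}{(\log n)^2}\right)=O_\beta\left(\frac{n^{2-3\beta}}{(\log n)^2}\right).$$ In particular, no positive constant multiple of $\rho(G)^3n^2$ can be forced uniformly (as a lower bound for the largest number of edges of an internally strongly $C_6$-connected subgraph) at any fixed density scale $\rho(G)=\Theta(n^{-\beta})$ with $\beta\in[1/3,1/2)$.
   Context: All graphs are finite and simple; $e(G)$ is the number of edges. A cycle is a simple cycle, not necessarily induced; $C_r$ denotes a cycle of length $r$. A bipartite graph $H$ is internally strongly $C_6$-connected if every two distinct edges of $H$ lie together on a $C_4$ or $C_6$ contained in $H$, and every two adjacent distinct edges of $H$ (edges sharing an endpoint) lie together on a $C_4$ contained in $H$. Constants implicit in $O_\beta,\Theta_\beta$ depend only on $\beta$. *)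

(* Defs.v *)
From HB Require Import structures.
From mathcomp Require Import all_boot all_order all_algebra.
From mathcomp Require Import reals exp.
Set Implicit Arguments.
Unset Strict Implicit.
Unset Printing Implicit Defensive.
Import Order.TTheory GRing.Theory Num.Theory.

(* A finite simple graph with its vertices in a finite type T. The vertex set
   need not be all of T, so that a graph and its subgraphs have the same type. *)
Record graph (T : finType) := Graph {
  vset : {set T};
  eset : {set {set T}};
  esetP : forall e, e \in eset -> (e \subset vset) && (#|e| == 2)
}.

Section Graphs.
Variable T : finType.
Implicit Types (G H : graph T) (e f : {set T}) (c : seq T) (r : nat).

Definition esize G : nat := #|eset G|.

Definition subgraph H G : bool :=
  (vset H \subset vset G) && (eset H \subset eset G).

Definition bipartite G : Prop :=
  exists A : {set T}, forall x y,
    [set x; y] \in eset G -> (x \in A) != (y \in A).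

Definition cycle_edges c : {set {set T}} :=
  [set [set x; next c x] | x in c].

(* c lists, in cyclic order and without repetition, the vertices of a C_r
   contained in G; chords are allowed. *)
Definition is_cycle G r c : bool :=
  [&& 2 < r, size c == r, uniq c & cycle_edges c \subset eset G].

Definition on_common_cycle G r e f : Prop :=
  exists c, [/\ is_cycle G r c, e \in cycle_edges c & f \in cycle_edges c].

Definition internally_strongly_C6_connected H : Prop :=
  [/\ bipartite H,
      forall e f, e \in eset H -> f \in eset H -> e != f ->
        on_common_cycle H 4 e f \/ on_common_cycle H 6 e f
    & forall e f, e \in eset H -> f \in eset H -> e != f ->
        e :&: f != set0 -> on_common_cycle H 4 e f].

End Graphs.

Local Open Scope ring_scope.

Definition density (R : realType) (T : finType) (G : graph T) : R :=
  (esize G)%:R / #|vset G|%:R ^+ 2.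

(* Main.v *)
Require Import Defs.
From HB Require Import structures.
From mathcomp Require Import all_boot all_order all_algebra.
From mathcomp Require Import reals exp.
From mathcomp Require boolp.
From mathcomp Require Import zify ring lra.
Set Implicit Arguments.
Unset Strict Implicit.
Unset Printing Implicit Defensive.

(** Let Z be an abelian group of order q and I a set of N indices, with
    q ~ n^beta and N q ~ n. A labelling W : I x I -> Z defines a bipartite
    graph (a Z-lift of K_{N,N}) on two copies of I x Z by joining (i, b) to
    (j, c) when b + c = W (i, j); it has N^2 q edges and density 1 / (4q), and
    W is chosen at random.
    In an internally strongly C6-connected subgraph any two vertices of the same
    side have two common neighbours. Two vertices of one fibre {i} x Z have
    none, so both sides A and B of the subgraph are partial functions I -> Z.
    By a union bound, e(A, B) < 8ab/q + 1 + 8h(a + b) for all such A and B, where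
    h = log2 q. Counting the pairs of A through their common neighbours, the
    columns of degree O(a/q + h) cover less than half of the pairs (N << q^2),
    and the others carry only O(ha) edges: so some vertex y sees a set S of at
    least a/O(h) points of A. If |S| >= N / 2^l, with h of order l^2, then S
    determines its own fibre coordinates through y, so a union bound over such
    stars needs only O(l |S|) bits. It shows that the heavy columns other than
    y have degree O(l/h) |S| in S and carry O(l |S|) edges in total, which is
    too little to give every pair of S a second common neighbour. Hence
    a, b <= N / h, and e(A, B) = O(N^2 / (q h^2)). *)

Import GRing.Theory.

(** * Binomial estimates and the union bound *)

Lemma fact_exp_le n k : n ^ k * n`! <= (n + k)`!.
Proof.
elim: k => [|k IH]; first by rewrite addn0 mul1n.
rewrite addnS factS expnS -mulnA leq_mul //; lia.
Qed.

Lemma bin_le_exp n k : 'C(n, k) * k`! <= n ^ k.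
Proof.
rewrite bin_ffact; elim: k n => [|k IH] n //.
case: n => [|n]; first by rewrite ffact0n.
rewrite ffactSS expnS leq_mul //; apply: leq_trans (IH n) _.
by case: k {IH} => // k; rewrite leq_exp2r.
Qed.

Lemma bin_leq_exp n k : 'C(n, k) <= n ^ k.
Proof. by apply: leq_trans (bin_le_exp n k); rewrite leq_pmulr ?fact_gt0. Qed.

Lemma bin_leq_exp2 n k : 'C(n, k) <= 2 ^ n.
Proof.
have [le_kn|lt_nk] := leqP k n; last by rewrite bin_small.
rewrite -[2]/(1 + 1) expnDn (bigD1 (Ordinal (le_kn : k < n.+1))) //=.
by rewrite !exp1n !muln1 leq_addr.
Qed.

(** A crude Stirling bound: $k^k k! \le (2k)! = \binom{2k}{k} k!^2$ and $\binom{2k}{k} \le 4^k$. *)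
Lemma exp_self_le k : k ^ k <= 4 ^ k * k`!.
Proof.
have h1 := fact_exp_le k k; have h2 := bin_leq_exp2 (k + k) k.
have h3 := bin_fact (leq_addr k k); rewrite addnK in h3.
have -> : 4 ^ k = 2 ^ (k + k) by rewrite addnn -mul2n expnM.
rewrite -(leq_pmul2r (fact_gt0 k)) (leq_trans h1) // -h3 -mulnA.
by rewrite leq_mul2r h2 orbT.
Qed.

Lemma bin_self_le n k : 'C(n, k) * k ^ k <= (4 * n) ^ k.
Proof.
apply: leq_trans (leq_mul (leqnn _) (exp_self_le k)) _.
by rewrite mulnCA expnMn leq_mul2l bin_le_exp orbT.
Qed.

(** First-moment bound for $n$ independent trials of probability $1/q$: once $k$ is at least eight
    times the mean, the expected number of $k$-sets of successes is at most $2^{-k}$, because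
    $\binom{n}{k} \le (4n/k)^k$. *)
Lemma bin_half n k q : 0 < k -> 8 * n <= q * k -> 'C(n, k) * 2 ^ k <= q ^ k.
Proof.
move=> k0 h; have := bin_self_le n k.
rewrite -(leq_pmul2r (expn_gt0 2 k : 0 < 2 ^ k)) -!expnMn => h2.
have kk : 0 < k ^ k by rewrite expn_gt0 k0.
rewrite -(leq_pmul2r kk) -expnMn mulnAC (leq_trans h2) //.
by rewrite leq_exp2r //; lia.
Qed.

(** An event in which the labels on [S] are functions of the others has probability at most
    $|Z|^{-|S|}$: overwriting [S] by a constant is injective on [D]. *)
Lemma card_determined (P Z : finType) (S : {set P}) (D : {set {ffun P -> Z}}) :
  (forall W W', W \in D -> W' \in D ->
    (forall p, p \notin S -> W p = W' p) -> W = W') ->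
  #|D| * #|Z| ^ #|S| <= #|Z| ^ #|P|.
Proof.
move=> detD; have [->|[W0 _]] := set_0Vmem D; first by rewrite cards0.
have [->|[p0 _]] := set_0Vmem S.
  by rewrite cards0 muln1 -card_ffun max_card.
(* [Z] may be empty, so the constant is taken from a member of [D]. *)
pose z0 := W0 p0.
pose r (W : {ffun P -> Z}) := [ffun p => if p \in S then z0 else W p].
have inj : {in D &, injective r}.
  move=> W W' WD W'D /ffunP e; apply: detD => // p /negbTE pS.
  by have := e p; rewrite !ffunE pS.
have sub : r @: D \subset pffun_on z0 (mem (~: S)) predT.
  apply/subsetP => _ /imsetP[W _ ->]; apply/pffun_onP; split=> //.
  apply/supportP => p; rewrite !inE negbK ffunE => -> //.
have := subset_leq_card sub; rewrite card_in_imset // card_pffun_on => hD.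
apply: leq_trans (leq_mul hD (leqnn _)) _.
by rewrite -expnD -(cardsC S) addnC.
Qed.

Lemma union_le (C O : finType) (Q : pred C) (D : C -> {set O}) (K M : nat) :
  (forall c, Q c -> #|D c| * K <= M) -> #|\bigcup_(c | Q c) D c| * K <= #|Q| * M.
Proof.
move=> hD; apply: (@leq_trans (\sum_(c | Q c) #|D c| * K)).
  rewrite -big_distrl leq_mul2r; apply/orP; right.
  elim/big_rec2: _ => [|c s S _ IH]; first by rewrite cards0.
  by rewrite (leq_trans (leq_card_setU _ _)) ?leq_add2l.
by rewrite -sum_nat_const leq_sum.
Qed.

(** * Counting labellings *)

Section Lift.
Variables (I : finType) (Z : finZmodType).
Implicit Types (W : {ffun I * I -> Z}) (x y : I * Z) (A B : {set I * Z}).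

Definition adj W x y := (x.2 + y.2)%R == W (x.1, y.1).

Definition edges W A B := [set p in setX A B | adj W p.1 p.2].

(** The edges from the section [f] over [R] to [B], recorded by index and vertex: the positions stay
    meaningful when [f] itself depends on the labelling. *)
Definition hits (f : I -> Z) (R : {set I}) B W :=
  [set p in setX R B | (f p.1 + p.2.2)%R == W (p.1, p.2.1)].

(* The values of [W] at the hit positions are determined by the other values,
   as [F W] does not depend on the columns of [B]. *)
Lemma card_hits_ge (F : {ffun I * I -> Z} -> I -> Z) (R : {set I}) B m :
  {in B &, injective fst} ->
  (forall W W', (forall i j, j \notin fst @: B -> W (i, j) = W' (i, j)) ->
     F W =1 F W') ->
  #|[set W | m <= #|hits (F W) R B W|]| * #|Z| ^ m
    <= 'C(#|R| * #|B|, m) * #|Z| ^ #|{: I * I}|.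
Proof.
move=> injB FP.
pose Q := [set S : {set I * (I * Z)} | S \subset setX R B & #|S| == m].
pose D (S : {set I * (I * Z)}) := [set W | S \subset hits (F W) R B W].
have cQ : #|Q| = 'C(#|R| * #|B|, m) by rewrite cards_draws cardsX.
rewrite -cQ; apply: leq_trans (_ : #|\bigcup_(S in Q) D S| * #|Z| ^ m <= _); last first.
  apply: union_le => S; rewrite inE => /andP[sS /eqP <-].
  (* The position of the label that a hit reads. Distinct hits read distinct labels because [B]
     meets each fibre at most once. *)
  pose g (p : I * (I * Z)) := (p.1, p.2.1).
  have injg : {in S &, injective g}.
    move=> [i [j b]] [i' [j' b']] /(subsetP sS); rewrite in_setX /= => /andP[_ p].
    move=> /(subsetP sS); rewrite in_setX /= => /andP[_ p'] [-> e].
    by have [-> ->] := injB _ _ p p' e.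
  rewrite -(card_in_imset injg); apply: card_determined => W W'.
  rewrite !inE => /subsetP SW /subsetP SW' e; apply/ffunP => p.
  have [|/e //] := boolP (p \in g @: S).
  case/imsetP=> t tS -> {p}.
  have := SW _ tS; have := SW' _ tS; rewrite !inE => /andP[_ /eqP<-] /andP[_ /eqP<-].
  congr (_ + _)%R; apply: FP => i j jB; apply: e; apply: contra jB.
  case/imsetP => u uS [_ ->]; apply: imset_f.
  by have := subsetP sS _ uS; rewrite inE => /andP[].
rewrite leq_mul2r subset_leq_card ?orbT //; apply/subsetP => W; rewrite inE => hm.
have [S sS cS] : exists2 S : {set _}, S \subset hits (F W) R B W & #|S| = m.
  have /card_gt0P[S] : 0 < #|[set S : {set _} | S \subset hits (F W) R B W & #|S| == m]|.
    by rewrite cards_draws bin_gt0.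
  by rewrite inE => /andP[? /eqP ?]; exists S.
apply/bigcupP; exists S; last by rewrite inE.
rewrite inE cS eqxx andbT (subset_trans sS) //.
by apply/subsetP => p; rewrite inE => /andP[].
Qed.

Lemma card_hits_half (F : {ffun I * I -> Z} -> I -> Z) (R : {set I}) B m :
  {in B &, injective fst} ->
  (forall W W', (forall i j, j \notin fst @: B -> W (i, j) = W' (i, j)) ->
     F W =1 F W') ->
  0 < m -> 8 * (#|R| * #|B|) <= #|Z| * m ->
  #|[set W | m <= #|hits (F W) R B W|]| * 2 ^ m <= #|Z| ^ #|{: I * I}|.
Proof.
move=> injB FP m0 hm; have h1 := card_hits_ge R m injB FP.
have h2 := bin_half m0 hm.
have q0 : 0 < #|Z| ^ m by rewrite expn_gt0; apply/orP; left; apply/card_gt0P; exists 0%R.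
rewrite -(leq_pmul2r q0) mulnAC (leq_trans (leq_mul h1 (leqnn _))) //.
by rewrite mulnAC mulnC leq_mul2l h2 orbT.
Qed.

Lemma edges_hits W A B f :
  {in A &, injective fst} -> {in A, forall x, f x.1 = x.2} ->
  #|edges W A B| <= #|hits f (fst @: A) B W|.
Proof.
move=> injA fA; pose g (p : (I * Z) * (I * Z)) := (p.1.1, p.2).
have injg : {in edges W A B &, injective g}.
  move=> [x y] [x' y']; rewrite !inE /= => /andP[/andP[xA _] _] /andP[/andP[x'A _] _].
  by case=> e ->; rewrite (injA _ _ xA x'A e).
rewrite -(card_in_imset injg); apply: subset_leq_card; apply/subsetP => _ /imsetP[[x y] + ->].
rewrite !inE /= /adj => /andP[/andP[xA ->] /= /eqP <-].
by rewrite imset_f //= fA.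
Qed.

End Lift.

(** * Sparsity of random labellings *)

Section Good.
Variables (I : finType) (Z : finZmodType) (h v l : nat).
Implicit Types (W : {ffun I * I -> Z}) (x y : I * Z) (A B : {set I * Z}).

Definition transversal A := #|fst @: A| == #|A|.

(** With $q = 2^h$, the first term is eight times the expected number of edges, [1] makes up for the
    rounding, and the last term pays for the choice of [A] and [B]. *)
Definition sparse W := forall A B, transversal A -> transversal B ->
  0 < #|A| -> 0 < #|B| ->
  #|edges W A B| < (8 * (#|A| * #|B|)) %/ 2 ^ h + 1 + 8 * h * (#|A| + #|B|).

(** For a large star [A] at [y] the choice of [A] costs only $O(l|A|)$ bits. Sets [B] meeting the
    fibre of [y] are excluded, since the labels of that column determine the star. *)
Definition sparse_at W y A := forall B, transversal B -> y.1 \notin fst @: B ->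
  0 < #|B| ->
  #|edges W A B| < (8 * (#|A| * #|B|)) %/ 2 ^ h + 1 + ((l + 3) * #|A| + 8 * h * #|B|).

Definition low_degree_at W y A := forall y', y'.1 != y.1 ->
  #|edges W A [set y']| <= ((l + 5) * #|A|) %/ h.

Definition sparse_stars W := forall y A, (forall x, x \in A -> adj W x y) ->
  2 ^ v <= #|A| * 2 ^ l -> sparse_at W y A /\ low_degree_at W y A.

Hypothesis cardZ : #|Z| = 2 ^ h.
Hypothesis cardI : #|I| = 2 ^ v.
Hypothesis h_gt0 : 0 < h.
Hypothesis vh : v <= 2 * h.

Let M := #|Z| ^ #|{: I * I}|.

Lemma card_vertex : #|{: I * Z}| = 2 ^ (v + h).
Proof. by rewrite card_prod cardI cardZ expnD. Qed.

Lemma bin_vertex_le a : 'C(#|{: I * Z}|, a) <= 2 ^ (3 * h * a).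
Proof.
rewrite (leq_trans (bin_leq_exp _ _)) // card_vertex -expnM leq_exp2l //.
by rewrite leq_mul2r; apply/orP; right; lia.
Qed.

(** From $\binom{N}{D} \le (4N/D)^D$: a set of at least $N/2^l$ indices costs $l+2$ bits per
    element, whereas a vertex of [I * Z] costs up to $3h$. *)
Lemma bin_row_le D : 2 ^ v <= D * 2 ^ l -> 'C(#|I|, D) <= 2 ^ ((l + 2) * D).
Proof.
move=> hD; have D0 : 0 < D by move: hD; case: D; rewrite // mul0n leqn0 expn_eq0.
have DD : 0 < D ^ D by rewrite expn_gt0 D0.
rewrite -(leq_pmul2r DD) (leq_trans (bin_self_le _ _)) // expnM -expnMn cardI.
rewrite leq_exp2r // expnD; lia.
Qed.

Lemma transversal_inj A : transversal A -> {in A &, injective fst}.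
Proof. by move/imset_injP. Qed.

Lemma transversal_leq A : transversal A -> #|A| <= 2 ^ v.
Proof. by move/eqP <-; rewrite -cardI max_card. Qed.

(** The partial function whose graph is a transversal [A]. Its default value [0] is harmless, since
    [hits] is applied over [fst @: A]. *)
Definition lift_at A (i : I) : Z := odflt 0%R (omap snd [pick x in A | x.1 == i]).

Lemma lift_atP A : transversal A -> {in A, forall x, lift_at A x.1 = x.2}.
Proof.
move=> /transversal_inj tA x xA; rewrite /lift_at; case: pickP => [x'|/(_ x)].
  by case/andP=> x'A /eqP /(tA _ _ x'A xA) ->.
by rewrite xA eqxx.
Qed.

Lemma sizes_le : (2 ^ v).+1 <= 2 ^ (2 * h + 1).
Proof.
apply: (@leq_trans (2 ^ (v + 1))); last by rewrite leq_exp2l //; lia.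
by rewrite expnD muln2 -addnn -addn1 leq_add2l expn_gt0.
Qed.

Lemma cardIS : #|'I_(2 ^ v).+1| <= 2 ^ (2 * h + 1).
Proof. by rewrite card_ord sizes_le. Qed.

(** For sizes $a, b \ge 1$ the choice of the sets costs $3h(a+b)$ bits out of the exponent [m a b],
    leaving at least $5h(a+b) \ge 10h$. Of these, $4h+2$ pay for the pairs of sizes and three give
    the factor $1/8$. *)
Lemma few_not_sparse : exists bad : {set {ffun I * I -> Z}},
  #|bad| * 8 <= M /\ forall W, W \notin bad -> sparse W.
Proof.
pose m a b := (8 * (a * b)) %/ 2 ^ h + 1 + 8 * h * (a + b).
pose T := ('I_(2 ^ v).+1 * 'I_(2 ^ v).+1)%type.
pose Q (t : T) := [pred S : {set I * Z} * {set I * Z} |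
  [&& transversal S.1, transversal S.2, #|S.1| == t.1 & #|S.2| == t.2]].
pose D (S : {set I * Z} * {set I * Z}) :=
  [set W | m #|S.1| #|S.2| <= #|hits (lift_at S.1) (fst @: S.1) S.2 W|].
exists (\bigcup_(t : T | (0 < t.1) && (0 < t.2)) \bigcup_(S | Q t S) D S); split; last first.
  move=> W nW A B tA tB A0 B0; rewrite ltnNge; apply: contra nW => hW.
  have lt A' : transversal A' -> #|A'| < (2 ^ v).+1 by rewrite ltnS => /transversal_leq.
  apply/bigcupP; exists (Ordinal (lt _ tA), Ordinal (lt _ tB)); rewrite /= ?A0 //.
  apply/bigcupP; exists (A, B); first by rewrite /= tA tB !eqxx.
  by rewrite inE (leq_trans hW) // edges_hits //; [exact: transversal_inj|exact: lift_atP].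
have bnd (t : T) : (0 < t.1) && (0 < t.2) ->
    #|\bigcup_(S | Q t S) D S| * 2 ^ (10 * h) <= M.
  case: t => [a b] /= /andP[a0 b0].
  have u : #|\bigcup_(S | Q (a, b) S) D S| * 2 ^ m a b <= #|Q (a, b)| * M.
    apply: union_le => S /and4P[t1 t2 /eqP s1 /eqP s2].
    have := @card_hits_half _ _ (fun=> lift_at S.1) (fst @: S.1) S.2 (m a b).
    rewrite /D (eqP t1) s1 s2; apply=> //; first exact: transversal_inj.
      by rewrite /m addn1 addSn.
    rewrite cardZ [_ * m a b]mulnC (leq_trans (ltnW (ltn_ceil _ (expn_gt0 2 h)))) //.
    by rewrite leq_mul2r /m addn1 leq_addr orbT.
  have cQ : #|Q (a, b)| <= 2 ^ (3 * h * (a + b)).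
    pose dr k := [set S : {set I * Z} | #|S| == k].
    apply: (@leq_trans #|setX (dr a) (dr b)|).
      by apply: subset_leq_card; apply/subsetP => S; rewrite !inE => /and4P[_ _ -> ->].
    by rewrite cardsX !card_draws mulnDr expnD leq_mul // bin_vertex_le.
  have := leq_trans u (leq_mul cQ (leqnn M)).
  have le_m : 3 * h * (a + b) + 10 * h <= m a b by apply: leq_trans (leq_addl _ _); nia.
  rewrite -(subnKC (leq_trans (leq_addr _ _) le_m)) expnD mulnCA leq_pmul2l ?expn_gt0 //.
  apply: leq_trans; rewrite leq_mul2l leq_exp2l // leq_subRL ?le_m ?orbT //.
  by rewrite (leq_trans _ le_m) ?leq_addr.
have := union_le bnd; set U := #|_|; move=> hU.
have hT : #|[pred t : T | (0 < t.1) && (0 < t.2)]| <= 2 ^ (4 * h + 2).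
  apply: leq_trans (max_card _) _.
  have -> : 4 * h + 2 = (2 * h + 1) + (2 * h + 1) by lia.
  by rewrite card_prod expnD (leq_mul cardIS cardIS).
have := leq_trans hU (leq_mul hT (leqnn M)).
have -> : 10 * h = (4 * h + 2) + (6 * h - 2) by lia.
rewrite expnD mulnCA leq_pmul2l ?expn_gt0 //; apply: leq_trans.
by rewrite leq_mul2l (@leq_exp2l 2 3) ?orbT //; lia.
Qed.

Hypothesis lv : 2 ^ l * (4 * h + 5) <= 2 ^ v.

(** The unique label over [i] adjacent to [y]. It reads only the column of [y], and a star is thus
    given by [y] and its set of indices. *)
Definition star_at y W (i : I) : Z := (W (i, y.1) - y.2)%R.

Lemma star_at_local y B : y.1 \notin fst @: B ->
  forall W W', (forall i j, j \notin fst @: B -> W (i, j) = W' (i, j)) ->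
    star_at y W =1 star_at y W'.
Proof. by move=> yB W W' e i; rewrite /star_at e. Qed.

Lemma star_atP W y A : (forall x, x \in A -> adj W x y) ->
  transversal A /\ {in A, forall x, star_at y W x.1 = x.2}.
Proof.
move=> sA; have e : {in A, forall x, star_at y W x.1 = x.2}.
  by move=> x /sA /eqP; rewrite /star_at => <-; rewrite addrK.
split=> //; apply/imset_injP => x x' xA x'A e1.
by rewrite [x]surjective_pairing [x']surjective_pairing -!e // e1.
Qed.

Lemma large_star D : 2 ^ v <= D * 2 ^ l -> 4 * h + 5 <= D.
Proof.
by move=> hD; rewrite -(leq_pmul2l (expn_gt0 2 l : 0 < 2 ^ l)) (leq_trans lv) // mulnC.
Qed.

(** A star costs $3h$ bits for [y] and $(l+2)a$ for its indices, and [B] costs $3hb$. The surplus $a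
    + 5hb - 3h$ in [m a b] is at least $4h+5$ because [lv] forces $a \ge 4h+5$. *)
Lemma few_dense_stars : exists bad : {set {ffun I * I -> Z}},
  #|bad| * 8 <= M /\ forall W, W \notin bad -> forall y A,
    (forall x, x \in A -> adj W x y) -> 2 ^ v <= #|A| * 2 ^ l -> sparse_at W y A.
Proof.
pose m a b := (8 * (a * b)) %/ 2 ^ h + 1 + ((l + 3) * a + 8 * h * b).
pose T := ('I_(2 ^ v).+1 * 'I_(2 ^ v).+1)%type.
pose C := (((I * Z) * {set I}) * {set I * Z})%type.
pose Q (t : T) := [pred c : C |
  [&& transversal c.2, c.1.1.1 \notin fst @: c.2, #|c.1.2| == t.1 & #|c.2| == t.2]].
pose D (c : C) :=
  [set W | m #|c.1.2| #|c.2| <= #|hits (star_at c.1.1 W) c.1.2 c.2 W|].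
pose ok (t : T) := (2 ^ v <= t.1 * 2 ^ l) && (0 < t.2).
exists (\bigcup_(t : T | ok t) \bigcup_(c | Q t c) D c); split; last first.
  move=> W nW y A sA lA B tB yB B0; rewrite ltnNge; apply: contra nW => hW.
  have [tA eA] := star_atP sA.
  have lt A' : transversal A' -> #|A'| < (2 ^ v).+1 by rewrite ltnS => /transversal_leq.
  apply/bigcupP; exists (Ordinal (lt _ tA), Ordinal (lt _ tB)); rewrite /ok /= ?lA //.
  apply/bigcupP; exists ((y, fst @: A), B); first by rewrite /= tB yB (eqP tA) !eqxx.
  by rewrite inE /= (eqP tA) (leq_trans hW) // edges_hits //; exact: transversal_inj.
have bnd (t : T) : ok t -> #|\bigcup_(c | Q t c) D c| * 2 ^ (4 * h + 5) <= M.
  case: t => [a b] /= /andP[/= a0 b0].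
  have u : #|\bigcup_(c | Q (a, b) c) D c| * 2 ^ m a b <= #|Q (a, b)| * M.
    apply: union_le => c /and4P[t2 yc /eqP s1 /eqP s2].
    have := @card_hits_half _ _ (star_at c.1.1) c.1.2 c.2 (m a b).
    rewrite /D s1 s2; apply=> //; first exact: transversal_inj.
    - exact: star_at_local.
    - by rewrite /m addn1 addSn.
    rewrite cardZ [_ * m a b]mulnC (leq_trans (ltnW (ltn_ceil _ (expn_gt0 2 h)))) //.
    by rewrite leq_mul2r /m addn1 leq_addr orbT.
  have cQ : #|Q (a, b)| <= 2 ^ (3 * h + (l + 2) * a + 3 * h * b).
    pose dr (X : finType) k := [set S : {set X} | #|S| == k].
    apply: (@leq_trans #|setX (setX [set: I * Z] (dr I a)) (dr (I * Z)%type b)|).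
      by apply: subset_leq_card; apply/subsetP => S; rewrite !inE => /and4P[_ _ -> ->].
    rewrite !cardsX !card_draws cardsT 2!expnD !leq_mul ?bin_vertex_le ?bin_row_le //.
    by rewrite card_vertex leq_exp2l //; lia.
  have := leq_trans u (leq_mul cQ (leqnn M)).
  set e := _ + _ * b; have le_e : e + (4 * h + 5) <= m a b.
    by apply: leq_trans (leq_addl _ _); rewrite /e; have := large_star a0; nia.
  rewrite -(subnKC (leq_trans (leq_addr _ _) le_e)) expnD mulnCA leq_pmul2l ?expn_gt0 //.
  apply: leq_trans; rewrite leq_mul2l leq_exp2l // leq_subRL ?le_e ?orbT //.
  by rewrite (leq_trans _ le_e) ?leq_addr.
have := union_le bnd; set U := #|_|; move=> hU.
have hT : #|ok| <= 2 ^ (4 * h + 2).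
  apply: leq_trans (max_card _) _.
  have -> : 4 * h + 2 = (2 * h + 1) + (2 * h + 1) by lia.
  by rewrite card_prod expnD (leq_mul cardIS cardIS).
have := leq_trans hU (leq_mul hT (leqnn M)).
have -> : 4 * h + 5 = (4 * h + 2) + 3 by lia.
by rewrite expnD mulnCA leq_pmul2l ?expn_gt0.
Qed.

(** The threshold is far above the mean, so the choices of [m a] hit positions are simply bounded by
    $2^a$ and each hit gains $h$ bits. The gain, at least $(l+5)a$, exceeds the cost $6h + (l+3)a$
    by $2a - 6h \ge 2h + 4$. *)
Lemma few_high_degrees : exists bad : {set {ffun I * I -> Z}},
  #|bad| * 8 <= M /\ forall W, W \notin bad -> forall y A,
    (forall x, x \in A -> adj W x y) -> 2 ^ v <= #|A| * 2 ^ l -> low_degree_at W y A.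
Proof.
pose m a := ((l + 5) * a) %/ h + 1.
pose T := 'I_(2 ^ v).+1.
pose C := (((I * Z) * {set I}) * (I * Z))%type.
pose Q (t : T) := [pred c : C | (c.2.1 != c.1.1.1) && (#|c.1.2| == t)].
pose D (c : C) :=
  [set W | m #|c.1.2| <= #|hits (star_at c.1.1 W) c.1.2 [set c.2] W|].
pose ok (t : T) := (2 ^ v <= t * 2 ^ l).
exists (\bigcup_(t : T | ok t) \bigcup_(c | Q t c) D c); split; last first.
  move=> W nW y A sA lA y' yy'; rewrite leqNgt; apply: contra nW => hW.
  have [tA eA] := star_atP sA.
  have lt A' : transversal A' -> #|A'| < (2 ^ v).+1 by rewrite ltnS => /transversal_leq.
  apply/bigcupP; exists (Ordinal (lt _ tA)); rewrite /ok /= ?lA //.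
  apply/bigcupP; exists ((y, fst @: A), y'); first by rewrite /= yy' (eqP tA) !eqxx.
  rewrite inE /= (eqP tA); apply: leq_trans (edges_hits W [set y'] (transversal_inj tA) eA).
  by rewrite /m addn1.
have bnd (t : T) : ok t -> #|\bigcup_(c | Q t c) D c| * 2 ^ (2 * h + 4) <= M.
  move: t => a /= a0.
  have u : #|\bigcup_(c | Q a c) D c| * 2 ^ (h * m a) <= #|Q a| * (2 ^ a * M).
    apply: union_le => c /andP[yc /eqP s1].
    have := @card_hits_ge _ _ (star_at c.1.1) c.1.2 [set c.2] (m a).
    rewrite cards1 muln1 s1 cardZ -expnM /D s1; move=> hh; apply: leq_trans (hh _ _) _.
    - by move=> ? ? /set1P-> /set1P->.
    - by apply: star_at_local; rewrite imset_set1 inE eq_sym.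
    by rewrite /M cardZ leq_mul2r bin_leq_exp2 orbT.
  have cQ : #|Q a| <= 2 ^ (3 * h + (l + 2) * a + 3 * h).
    apply: (@leq_trans #|setX (setX [set: I * Z] [set S : {set I} | #|S| == a]) [set: I * Z]|).
      by apply: subset_leq_card; apply/subsetP => S; rewrite !inE => /andP[_ ->].
    have vv : #|{: I * Z}| <= 2 ^ (3 * h) by rewrite card_vertex leq_exp2l //; lia.
    by rewrite !cardsX !card_draws !cardsT 2!expnD !leq_mul ?bin_row_le.
  have := leq_trans u (leq_mul cQ (leqnn _)); rewrite mulnA -expnD.
  set e := _ + a; have le_e : e + (2 * h + 4) <= h * m a.
    rewrite /m addn1 [h * _]mulnC; apply: leq_trans (ltnW (ltn_ceil _ h_gt0)).
    by rewrite /e; have := large_star a0; lia.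
  rewrite -(subnKC (leq_trans (leq_addr _ _) le_e)) expnD mulnCA leq_pmul2l ?expn_gt0 //.
  apply: leq_trans; rewrite leq_mul2l leq_exp2l // leq_subRL ?le_e ?orbT //.
  by rewrite (leq_trans _ le_e) ?leq_addr.
have := union_le bnd; set U := #|_|; move=> hU.
have hT : #|ok| <= 2 ^ (2 * h + 1) by apply: leq_trans (max_card _) cardIS.
have := leq_trans hU (leq_mul hT (leqnn M)).
have -> : 2 * h + 4 = (2 * h + 1) + 3 by lia.
by rewrite expnD mulnCA leq_pmul2l ?expn_gt0.
Qed.

End Good.

(** * Linked sets and the counting of pairs through common neighbours *)

Section Linked.
Variables (I : finType) (Z : finZmodType).
Implicit Types (W : {ffun I * I -> Z}) (x y : I * Z) (A B : {set I * Z}).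

Definition transpose W : {ffun I * I -> Z} := [ffun p => W (p.2, p.1)].

Lemma adj_transpose W x y : adj (transpose W) y x = adj W x y.
Proof. by rewrite /adj ffunE /= addrC. Qed.

Lemma transpose_inj : injective transpose.
Proof.
by apply: (can_inj (g := transpose)) => W; apply/ffunP => -[i j]; rewrite !ffunE.
Qed.

Lemma edges_transpose W A B : #|edges (transpose W) B A| = #|edges W A B|.
Proof.
pose s (p : (I * Z) * (I * Z)) := (p.2, p.1).
have injs : injective s by move=> [? ?] [? ?] [-> ->].
rewrite -(card_imset (edges W A B) injs); congr #|pred_of_set _|; apply/setP => -[y x].
apply/idP/imsetP => [|[[x' y'] + [-> ->]]]; rewrite !inE /= ?adj_transpose.
  by move=> /andP[/andP[yB xA] a]; exists (x, y); rewrite ?inE /= ?yB ?xA.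
by case/andP=> /andP[-> ->].
Qed.

(** Five exceptional sets, each of at most an eighth of all labellings, cannot cover everything.
    Transposition is injective, so the star conditions can be imposed from both sides. *)
Lemma exists_sparse (h v l : nat) :
  #|Z| = 2 ^ h -> #|I| = 2 ^ v -> 0 < h -> v <= 2 * h ->
  2 ^ l * (4 * h + 5) <= 2 ^ v ->
  exists W, [/\ sparse h W, sparse_stars h v l W & sparse_stars h v l (transpose W)].
Proof.
move=> cZ cI h0 vh lv.
have [b1 [c1 P1]] := few_not_sparse cZ cI h0 vh.
have [b2 [c2 P2]] := few_dense_stars cZ cI h0 vh lv.
have [b3 [c3 P3]] := few_high_degrees cZ cI h0 vh lv.
pose bad := b1 :|: (b2 :|: b3) :|: (transpose @^-1: b2 :|: transpose @^-1: b3).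
have [W nW] : exists W, W \notin bad.
  apply/existsP; rewrite -negb_forall; apply/negP => /forallP allbad.
  have cb : #|bad| = #|Z| ^ #|{: I * I}|.
    by rewrite -card_ffun; apply: eq_card => W; rewrite allbad.
  have M0 : 0 < #|Z| ^ #|{: I * I}| by rewrite cZ !expn_gt0.
  have : #|bad| <= #|b1| + (#|b2| + #|b3|) + (#|b2| + #|b3|).
    rewrite /bad; apply: leq_trans (leq_card_setU _ _) (leq_add _ _).
      apply: leq_trans (leq_card_setU _ _) _; rewrite leq_add2l; exact: leq_card_setU.
    apply: leq_trans (leq_card_setU _ _) _.
    by rewrite !(card_preimset _ transpose_inj).
  rewrite cb; move: c1 c2 c3 M0; move: (#|Z| ^ _) #|b1| #|b2| #|b3|; lia.
move: nW; rewrite !in_setU !negb_or !inE => /andP[/and3P[n1 n2 n3] /andP[n4 n5]].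
by exists W; split; [exact: P1 | |] => y A sA lA; split; [apply: P2|apply: P3|apply: P2|apply: P3].
Qed.

Definition nbhd W A y := [set x in A | adj W x y].

Lemma card_edges W A B : #|edges W A B| = \sum_(y in B) #|nbhd W A y|.
Proof.
rewrite -sum1_card (partition_big snd (mem B)) /=; last first.
  by move=> p; rewrite !inE => /andP[/andP[]].
apply: eq_bigr => y yB; rewrite sum1dep_card.
have inj : injective (fun x => (x, y)) by move=> x x' [].
rewrite -(card_imset (nbhd W A y) inj); apply: eq_card => -[x y'].
apply/idP/imsetP => [|[x' + [-> ->]]]; rewrite !inE /=.
  by case/andP=> /andP[/andP[xA _] xy] /eqP e; exists x; rewrite ?inE ?xA -?e.
by case/andP=> -> ->; rewrite yB eqxx.
Qed.

Lemma card_edges1 W A y : #|edges W A [set y]| = #|nbhd W A y|.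
Proof. by rewrite card_edges big_set1. Qed.

(** Each ordered pair of [A] lies in the square of the neighbourhood of a common neighbour.
    [1 < #|A|] serves the diagonal pairs: a second point gives [x] a neighbour in [B]. *)
Lemma cover_square W A B : 1 < #|A| ->
  (forall x x', x \in A -> x' \in A -> x != x' ->
     exists2 y, y \in B & adj W x y && adj W x' y) ->
  #|A| ^ 2 <= \sum_(y in B) #|nbhd W A y| ^ 2.
Proof.
move=> A1 cov'; have cov x x' : x \in A -> x' \in A ->
    exists2 y, y \in B & adj W x y && adj W x' y.
  move=> xA x'A; have [<-{x' x'A}|] := eqVneq x x'; last exact: cov'.
  have [x' /andP[x'A ne]] : exists x', (x' \in A) && (x != x').
    apply/existsP; apply: contraTT A1 => /existsPn al; rewrite -leqNgt.
    rewrite (leq_trans (subset_leq_card (_ : A \subset [set x]))) ?cards1 //.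
    by apply/subsetP => x' x'A; have := al x'; rewrite x'A /= negbK inE eq_sym.
  by have [y yB /andP[xy _]] := cov' _ _ xA x'A ne; exists y; rewrite ?xy.
rewrite -mulnn -cardsX.
under eq_bigr do rewrite -mulnn -cardsX.
apply: leq_trans (_ : #|\bigcup_(y in B) setX (nbhd W A y) (nbhd W A y)| <= _).
  apply: subset_leq_card; apply/subsetP => -[x x']; rewrite inE /= => /andP[xA x'A].
  have [y yB /andP[xy x'y]] := cov _ _ xA x'A.
  by apply/bigcupP; exists y; rewrite // !inE /= xA x'A xy.
elim/big_rec2: _ => [|y s S _ IH]; first by rewrite cards0.
by rewrite (leq_trans (leq_card_setU _ _)) ?leq_add2l.
Qed.

(* The vertices of [B] with at least [t] neighbours in [A] carry at most
   [2 * mu + 2] edges in total. *)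
Lemma sum_square_le h W A B (mu d : nat) :
  let t := (16 * #|A|) %/ 2 ^ h + 1 + 16 * h in
  (forall K : {set I * Z}, K \subset B -> 0 < #|K| ->
     #|edges W A K| < (8 * (#|A| * #|K|)) %/ 2 ^ h + 1 + (mu + 8 * h * #|K|)) ->
  (forall y, y \in B -> #|nbhd W A y| <= d) ->
  \sum_(y in B) #|nbhd W A y| ^ 2 <= d * (2 * mu + 2) + #|B| * t ^ 2.
Proof.
move=> t mass deg; pose K := [set y in B | t <= #|nbhd W A y|].
rewrite (bigID (fun y => t <= #|nbhd W A y|)) /= leq_add //; last first.
  apply: (@leq_trans (\sum_(y in B | ~~ (t <= #|nbhd W A y|)) t ^ 2)).
    by apply: leq_sum => y /andP[_]; rewrite -ltnNge => /ltnW; rewrite leq_sqr.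
  rewrite sum_nat_const leq_mul2r; apply/orP; right.
  by apply: subset_leq_card; apply/subsetP => y; rewrite unfold_in => /andP[].
apply: (@leq_trans (d * #|edges W A K|)).
  rewrite card_edges big_distrr /=.
  rewrite [X in _ <= X](eq_bigl (fun y => (y \in B) && (t <= #|nbhd W A y|))); last first.
    by move=> y; rewrite inE.
  by apply: leq_sum => y /andP[yB _]; rewrite -mulnn leq_mul2r deg ?orbT.
rewrite leq_mul2l; apply/orP; right.
have [K0|K0] := posnP #|K|.
  by rewrite (cards0_eq K0) card_edges big_set0.
have sK : K \subset B by apply/subsetP => y; rewrite inE => /andP[].
have lt := mass K sK K0.
have ge : #|K| * t <= #|edges W A K|.
  by rewrite card_edges -sum_nat_const; apply: leq_sum => y; rewrite inE => /andP[].
move: lt ge; rewrite /t; move: #|edges _ _ _| => e; move: #|K| K0 => k k0.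
set c := _ %/ _; set c' := _ %/ _.
(* Twice the mass bound contains [2 * c + 16 * h * k], which is at most [k * t] and hence at most
   [e]; what remains gives $e \le 2\mu + 2$. *)
have cc : 2 * c <= k * (c' + 1).
  have q0 : 0 < 2 ^ h by rewrite expn_gt0.
  rewrite -ltnS -(ltn_pmul2r q0).
  have := leq_trunc_div (8 * (#|A| * k)) (2 ^ h); have := ltn_ceil (16 * #|A|) q0.
  rewrite -/c -/c'; move: (2 ^ h) q0 => q q0; nia.
nia.
Qed.

(** Two common neighbours rather than one: deleting the centre of a star still leaves one for every
    pair of its points. *)
Definition linked W A B := forall x x', x \in A -> x' \in A -> x != x' ->
  exists y y', [/\ y \in B, y' \in B, y != y',
    adj W x y && adj W x' y & adj W x y' && adj W x' y'].

Lemma linked_transversal W A B : linked W A B -> transversal A.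
Proof.
move=> lk; apply/imset_injP => x x' xA x'A e; apply/eqP; apply: contraT => ne.
have [y [_ [_ _ _ /andP[/eqP xy /eqP x'y] _]]] := lk _ _ xA x'A ne.
have e2 : x.2 = x'.2 by apply: (addIr y.2); rewrite xy x'y e.
by case/negP: ne; rewrite [x]surjective_pairing [x']surjective_pairing e e2.
Qed.

End Linked.

(** Bounds the pairs seen by columns of degree below the threshold. With $q = 2^h$ and $r$ the
    quotient, [289] is $17^2$, from $1 + 16h \le 17h$, and $32 \cdot 64 = 8 \cdot 16^2$ turns $rq
    \le 16a$ into $8Nr^2 \le a^2$. *)
Lemma threshold_square_le h N a :
  0 < h -> 32 * 64 * N <= (2 ^ h) ^ 2 ->
  4 * (N * ((16 * a) %/ 2 ^ h + 1 + 16 * h) ^ 2) <= a ^ 2 + 8 * 289 * (h ^ 2 * N).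
Proof.
move=> h0 hN; have hr := leq_trunc_div (16 * a) (2 ^ h).
move: (2 ^ h) (_ %/ _) hN hr => q r hN hr.
have h1 : (r + 1 + 16 * h) ^ 2 <= 2 * r ^ 2 + 2 * 289 * h ^ 2.
  apply: (@leq_trans ((r + 17 * h) ^ 2)); first by rewrite leq_sqr; lia.
  rewrite sqrnD; have [+ _] := nat_Cauchy r (17 * h); rewrite !expnMn; lia.
have h2 : 8 * (N * r ^ 2) <= a ^ 2.
  have : 32 * 64 * N * r ^ 2 <= (16 * a) ^ 2.
    by rewrite (leq_trans (leq_mul hN (leqnn _))) // -expnMn leq_sqr mulnC.
  rewrite expnMn; lia.
have := leq_mul (leqnn N) h1; lia.
Qed.

(** * Linked sets are small *)

Section Bound.
Variables (I : finType) (Z : finZmodType) (h v l : nat).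
Implicit Types (W : {ffun I * I -> Z}) (x y : I * Z) (A B : {set I * Z}).

Hypothesis cardI : #|I| = 2 ^ v.
(** [lh] limits the pairs that heavy columns cover in a large star, [hl] those that small stars
    cover in [A], and [vh] those of light columns; [hv], with [hl], puts the sets in question above
    $h^2 \sqrt{N}$, where $N = 2^v$. *)
Hypothesis lh : 64 * (l + 5) ^ 2 <= h.
Hypothesis vh : 32 * 64 * 2 ^ v <= (2 ^ h) ^ 2.
Hypothesis hl : 36 * h ^ 2 <= 2 ^ l.
Hypothesis hv : h ^ 4 * 4 ^ l <= 2 ^ v.

Let h_gt0 : 0 < h. Proof. nia. Qed.

Let h_large : 16 * 289 <= h ^ 2.
Proof. have h70 : 70 <= h by nia. by have := leq_mul h70 h70; rewrite mulnn; lia. Qed.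

(** Every pair in the star [S] of [y] has a common neighbour other than [y]. If $D \ge N/2^l$ with
    $N = 2^v$, heavy columns cover at most $D^2/32$ pairs and light ones at most $3D^2/8$: too
    few. *)
Lemma star_lt W A B y : sparse_stars h v l W -> transversal B -> linked W A B ->
  y \in B -> #|nbhd W A y| * 2 ^ l < 2 ^ v.
Proof.
move=> gW tB lk yB; rewrite ltnNge; apply/negP => big.
set S := nbhd W A y; set D := #|S| in big.
have [dens deg] : sparse_at h l W y S /\ low_degree_at h l W y S.
  by apply: gW => // x; rewrite inE => /andP[].
have N0 : 0 < 2 ^ v by rewrite expn_gt0.
have D2 : h ^ 4 * 2 ^ v <= D ^ 2.
  have p0 : 0 < 4 ^ l by rewrite expn_gt0.
  rewrite -(leq_pmul2r p0) (_ : D ^ 2 * 4 ^ l = (D * 2 ^ l) ^ 2); last first.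
    by rewrite expnMn -expnM mulnC -[4]/(2 ^ 2) -expnM mulnC [l * 2]mulnC.
  apply: leq_trans (_ : (2 ^ v) ^ 2 <= _); last by rewrite leq_sqr.
  by rewrite mulnAC -mulnn leq_mul2r hv orbT.
have D1 : 1 < D.
  rewrite -(@leq_exp2r _ _ 2) //; apply: leq_trans D2.
  by apply: leq_trans (_ : h ^ 4 <= _); [nia|rewrite leq_pmulr].
have cov x x' : x \in S -> x' \in S -> x != x' ->
    exists2 z, z \in B :\ y & adj W x z && adj W x' z.
  rewrite !inE => /andP[xA _] /andP[x'A _] ne.
  have [z [z' [zB z'B zz' h1 h2]]] := lk _ _ xA x'A ne.
  have [e|ne'] := eqVneq z y; last by exists z; rewrite // !inE ne' zB.
  by exists z'; rewrite // !inE z'B -e eq_sym zz'.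
have sq := cover_square D1 cov.
have tI : {in B &, injective fst} by apply/imset_injP.
have le := @sum_square_le _ _ h W S (B :\ y) ((l + 3) * D) (((l + 5) * D) %/ h) _ _.
have {le} := leq_trans sq (le _ _).
have cB : #|B :\ y| <= 2 ^ v.
  rewrite (leq_trans (subset_leq_card (subD1set _ _))) //.
  by rewrite -(eqP tB) -cardI max_card.
move=> le; have {le} : D ^ 2 <= ((l + 5) * D) %/ h * (2 * ((l + 3) * D) + 2)
      + 2 ^ v * ((16 * D) %/ 2 ^ h + 1 + 16 * h) ^ 2.
  apply: leq_trans (le _ _) _ => [K sK K0|z|].
  (* As [B] is transversal, its vertices other than [y] avoid the fibre of [y], which [dens] and
     [deg] require. *)
  - apply: dens => //; last first.
      apply/negP => /imsetP[z zK e]; have := subsetP sK _ zK; rewrite !inE => /andP[/eqP ne zB].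
      by apply: ne; apply: tI.
    apply/imset_injP => z z' zK z'K; apply: tI.
      by have := subsetP sK _ zK; rewrite !inE => /andP[].
    by have := subsetP sK _ z'K; rewrite !inE => /andP[].
  - rewrite !inE => /andP[ne zB]; rewrite -card_edges1; apply: deg.
    by apply: contra ne => /eqP /tI ->.
  by rewrite leq_add2l leq_mul2r cB orbT.
have := threshold_square_le D h_gt0 vh.
have := leq_trunc_div ((l + 5) * D) h; move: (_ %/ h) => d hd.
set T := 2 ^ v * _ ^ 2 => hT hS.
have hd2 : 32 * (d * (2 * ((l + 3) * D) + 2)) <= D ^ 2.
  rewrite -(leq_pmul2l h_gt0).
  apply: (@leq_trans (64 * ((d * h) * ((l + 5) * D)))).
    have e1 : 2 * ((l + 3) * D) + 2 <= 2 * ((l + 5) * D) by lia.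
    by have := leq_mul (leqnn (32 * (d * h))) e1; lia.
  apply: (@leq_trans (64 * (((l + 5) * D) * ((l + 5) * D)))).
    by rewrite leq_pmul2l // leq_mul2r hd orbT.
  rewrite mulnn expnMn mulnA leq_mul2r lh orbT //.
have D3 : 16 * 289 * (h ^ 2 * 2 ^ v) <= D ^ 2.
  apply: leq_trans D2; rewrite mulnA leq_mul2r; apply/orP; right.
  by rewrite (_ : 4 = 2 + 2) // expnD leq_mul2r h_large orbT.
have := leq_mul D1 D1; rewrite mulnn; move: T hT hS; move: (d * _) hd2 => X; lia.
Qed.

(** With $N = 2^v$ and $a = |A|$, suppose $ah > N$. Heavy columns cover at most $a^2/2$ pairs, as
    [star_lt] caps their degrees at $N/2^l < ah/2^l$, and light ones at most $3a^2/8$. *)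
Lemma size_le W A B : sparse h W -> sparse_stars h v l W -> transversal B ->
  linked W A B -> 0 < #|B| -> #|A| * h <= 2 ^ v.
Proof.
move=> sW gW tB lk B0; rewrite leqNgt; apply/negP => big.
have tA := linked_transversal lk.
have [A1|A1] := leqP #|A| 1.
  have : #|A| * h <= 2 ^ v; last by rewrite leqNgt big.
  apply: leq_trans hv; apply: leq_trans (_ : h <= _).
    by move: A1; case: #|A| => [|[|]] //; rewrite ?mul1n.
  by rewrite expnS -mulnA leq_pmulr // !muln_gt0 !expn_gt0 h_gt0.
have cov x x' : x \in A -> x' \in A -> x != x' ->
    exists2 z, z \in B & adj W x z && adj W x' z.
  by move=> xA x'A ne; have [z [_ [zB _ _ h1 _]]] := lk _ _ xA x'A ne; exists z.
have sq := cover_square A1 cov.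
have tI : {in B &, injective fst} by apply/imset_injP.
have p0 : 0 < 2 ^ l by rewrite expn_gt0.
have := @sum_square_le _ _ h W A B (8 * h * #|A|) (2 ^ v %/ 2 ^ l).
have cB : #|B| <= 2 ^ v by rewrite -(eqP tB) -cardI max_card.
move=> le; have {le} : #|A| ^ 2 <= 2 ^ v %/ 2 ^ l * (2 * (8 * h * #|A|) + 2)
      + 2 ^ v * ((16 * #|A|) %/ 2 ^ h + 1 + 16 * h) ^ 2.
  apply: leq_trans sq (leq_trans (le _ _) _) => [K sK K0|z zB|].
  - rewrite -mulnDr; apply: sW => //; last by rewrite ltnW.
    by apply/imset_injP => z z' zK z'K; apply: tI; exact: (subsetP sK).
  - by rewrite leq_divRL // ltnW // (star_lt gW tB lk).
  by rewrite leq_add2l leq_mul2r cB orbT.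
have := threshold_square_le #|A| h_gt0 vh.
have hd := leq_trunc_div (2 ^ v) (2 ^ l).
set T := 2 ^ v * _ ^ 2; set d := _ %/ _ in hd *; set a := #|A| in big A1 *.
move=> hT hS.
have A2 : h ^ 4 * 2 ^ v <= a ^ 2.
  have hh : 0 < h ^ 2 by rewrite expn_gt0 h_gt0.
  have h6 : h ^ 4 * h ^ 2 <= 2 ^ v.
    apply: leq_trans hv; rewrite leq_mul2l; apply/orP; right.
    apply: leq_trans (_ : 2 ^ l <= _); last first.
      by rewrite -[4]/(2 ^ 2) -expnM leq_exp2l // mulSn leq_addr.
    by apply: leq_trans hl; rewrite leq_pmull.
  rewrite -(leq_pmul2r hh) -expnMn mulnAC.
  apply: leq_trans (leq_mul h6 (leqnn _)) _.
  by rewrite mulnn leq_sqr ltnW.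
have A3 : 16 * 289 * (h ^ 2 * 2 ^ v) <= a ^ 2.
  apply: leq_trans A2; rewrite mulnA leq_mul2r; apply/orP; right.
  by rewrite (_ : 4 = 2 + 2) // expnD leq_mul2r h_large orbT.
have hd2 : 2 * (d * (2 * (8 * h * a) + 2)) <= a ^ 2.
  rewrite -(leq_pmul2r p0).
  apply: (@leq_trans (36 * h * a * (d * 2 ^ l))).
    have ha : 0 < h * a by rewrite muln_gt0 h_gt0 ltnW.
    have e1 : 2 * (2 * (8 * h * a) + 2) <= 36 * h * a by clear -ha; lia.
    by have := leq_mul (leqnn (d * 2 ^ l)) e1; lia.
  apply: (@leq_trans (36 * h * a * (a * h))).
    by rewrite leq_mul2l (leq_trans hd (ltnW big)) orbT.
  apply: leq_trans (_ : 36 * h ^ 2 * a ^ 2 <= _); first by lia.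
  by rewrite mulnC leq_mul2l hl orbT.
have := leq_mul A1 A1; rewrite mulnn; move: T hT hS; move: (d * _) hd2 => X; lia.
Qed.

(** With $q = 2^h$ and $N = 2^v$, inserting $a, b \le N/h$ in [sparse] gives $8N^2/(qh^2)$ from the
    main term and $8h(a+b) \le 16N$ from the error, which the last hypothesis makes at most
    $N^2/(qh^2)$; hence the constant [9]. *)
Lemma linked_edges_le W A B : sparse h W -> sparse_stars h v l W ->
  sparse_stars h v l (transpose W) -> linked W A B -> linked (transpose W) B A ->
  16 * (2 ^ h * h ^ 2) <= 2 ^ v ->
  #|edges W A B| * (2 ^ h * h ^ 2) <= 9 * (2 ^ v) ^ 2.
Proof.
move=> sW gW gW' lk lk' hq.
have [A0|A0] := posnP #|A|; first by rewrite -edges_transpose card_edges (cards0_eq A0) big_set0.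
have [B0|B0] := posnP #|B|; first by rewrite card_edges (cards0_eq B0) big_set0.
have tA := linked_transversal lk; have tB := linked_transversal lk'.
have sW' : sparse h (transpose W).
  move=> A' B' tA' tB' A'0 B'0; rewrite edges_transpose (leq_trans (sW _ _ tB' tA' B'0 A'0)) //.
  by rewrite [#|B'| * _]mulnC [#|B'| + _]addnC.
have sA := size_le sW gW tB lk B0; have sB := size_le sW' gW' tA lk' A0.
have lt := sW _ _ tA tB A0 B0; have := leq_trunc_div (8 * (#|A| * #|B|)) (2 ^ h).
move: lt sA sB; move: (#|A|) (#|B|) #|edges _ _ _| => a b e; move: (_ %/ _) => c lt sA sB hc.
have ab : a * h * (b * h) <= 2 ^ v * 2 ^ v by apply: leq_mul.
have e1 : e <= c + 8 * h * (a + b) by lia.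
apply: leq_trans (leq_mul e1 (leqnn _)) _.
have e2 : c * (2 ^ h * h ^ 2) <= 8 * (2 ^ v) ^ 2.
  rewrite mulnA (leq_trans (leq_mul hc (leqnn _))) //; move: ab; nia.
have e3 : 8 * h * (a + b) * (2 ^ h * h ^ 2) <= (2 ^ v) ^ 2.
  apply: leq_trans (_ : (16 * 2 ^ v) * (2 ^ h * h ^ 2) <= _).
    rewrite leq_mul2r; apply/orP; right; nia.
  by rewrite mulnAC -mulnn leq_mul2r hq orbT.
rewrite mulnDl; lia.
Qed.

End Bound.

(** * Common neighbours in strongly connected graphs *)

Section CommonNeighbours.
Variables (T : finType) (H : graph T) (c : T -> bool).
Hypothesis c_proper : forall x y, [set x; y] \in eset H -> c x != c y.
Implicit Types (x y : T) (e : {set T}) (s : seq T).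

Let E x y := [set x; y] \in eset H.

Let E_sym x y : E x y = E y x. Proof. by rewrite /E setUC. Qed.

Lemma is_cycle_cycle r s : is_cycle H r s -> cycle E s.
Proof.
case/and4P=> _ _ us /subsetP sub.
apply: (sub_in_cycle (P := [in s]) _ _ (cycle_next us)); last by apply/allP.
by move=> x y xs _ /= /eqP <-; apply/sub/imset_f.
Qed.

Lemma mem_cycle_edges s e x : e \in cycle_edges s -> x \in e -> x \in s.
Proof.
by case/imsetP=> y ys ->; rewrite !inE => /orP[] /eqP ->; rewrite ?mem_next.
Qed.

(** Distinct vertices of one colour are opposite on a 4-cycle, so the other two vertices are common
    neighbours. *)
Lemma C4_common_neighbours s x x' : is_cycle H 4 s -> x \in s -> x' \in s ->
  x != x' -> c x = c x' ->
  exists y y', [/\ y != y', E x y && E x' y & E x y' && E x' y'].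
Proof.
move=> Hs; have cyc := is_cycle_cycle Hs; case/and4P: Hs => _ /eqP + us _.
case: s us cyc => [|a1 [|a2 [|a3 [|a4 []]]]] //= us /and5P[e1 e2 e3 e4 _] _.
have := c_proper e1; have := c_proper e2; have := c_proper e3; have := c_proper e4.
move=> c4 c3 c2 c1.
have [n13 n24] : a1 != a3 /\ a2 != a4.
  move: us; rewrite !inE !negb_or => /and4P[/and3P[_ -> _] /andP[_ ->]] //.
have n31 : a3 != a1 by rewrite eq_sym.
have n42 : a4 != a2 by rewrite eq_sym.
have [e1' e2' e3' e4'] : [/\ E a2 a1, E a3 a2, E a4 a3 & E a1 a4] by split; rewrite E_sym.
rewrite !inE => /or4P[] /eqP -> /or4P[] /eqP ->; rewrite ?eqxx // => _ cc;
  try by [move: c1 c2 c3 c4; rewrite cc; do 4!case: (c _)].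
- by exists a2, a4; rewrite e1 e2' e4' e3.
- by exists a1, a3; rewrite e1' e4 e2 e3'.
- by exists a2, a4; rewrite e1 e2' e4' e3.
- by exists a1, a3; rewrite e1' e4 e2 e3'.
Qed.

(** Distinct vertices of one colour on a 6-cycle are at distance two, and the vertex between them is
    adjacent to both. *)
Lemma C6_common_neighbour s x x' : is_cycle H 6 s -> x \in s -> x' \in s ->
  x != x' -> c x = c x' -> exists y, E x y && E x' y.
Proof.
move=> Hs; have cyc := is_cycle_cycle Hs; case/and4P: Hs => _ /eqP + _ _.
case: s cyc => [|a1 [|a2 [|a3 [|a4 [|a5 [|a6 []]]]]]] //=.
move=> /and5P[e1 e2 e3 e4 /and3P[e5 e6 _]] _.
have := c_proper e1; have := c_proper e2; have := c_proper e3; have := c_proper e4.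
have := c_proper e5; have := c_proper e6.
move=> c6 c5 c4 c3 c2 c1.
have [e1' e2' e3'] : [/\ E a2 a1, E a3 a2 & E a4 a3] by split; rewrite E_sym.
have [e4' e5' e6'] : [/\ E a5 a4, E a6 a5 & E a1 a6] by split; rewrite E_sym.
rewrite !inE => /or4P[|||/or3P[]] /eqP -> /or4P[|||/or3P[]] /eqP ->; rewrite ?eqxx // => _ cc;
  try by [move: c1 c2 c3 c4 c5 c6; rewrite cc; do 6!case: (c _)];
  by [exists a1; rewrite ?e1 ?e1' ?e6 ?e6' | exists a2; rewrite ?e1 ?e1' ?e2 ?e2'
    | exists a3; rewrite ?e3 ?e3' ?e2 ?e2' | exists a4; rewrite ?e3 ?e3' ?e4 ?e4'
    | exists a5; rewrite ?e5 ?e5' ?e4 ?e4' | exists a6; rewrite ?e5 ?e5' ?e6 ?e6'].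
Qed.

(** Edges through [x] and [x'] share a cycle. A $C_6$ supplies one common neighbour [y]; the edges
    from [x] and [x'] to [y] are then adjacent, and the $C_4$ through them supplies two. *)
Lemma strongly_connected_common_neighbours x x' e e' :
  internally_strongly_C6_connected H ->
  e \in eset H -> e' \in eset H -> x \in e -> x' \in e' -> x != x' -> c x = c x' ->
  exists y y', [/\ y != y', E x y && E x' y & E x y' && E x' y'].
Proof.
case=> _ conn adjconn eH e'H xe x'e' ne cc.
have edge2 f u u' : f \in eset H -> u \in f -> u' \in f -> u != u' -> c u != c u'.
  move=> fH uf u'f uu'; apply: c_proper; suff -> : [set u; u'] = f by [].
  apply/eqP; rewrite eqEcard cards2 uu' (eqP (andP (esetP fH)).2) leqnn andbT.
  by apply/subsetP => z; rewrite !inE => /orP[] /eqP ->.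
(* An edge has only one endpoint of each colour, so it cannot contain both [x] and [x']. *)
have ee' : e != e'.
  apply: contraTneq x'e' => <-; apply: contraL (eqxx (c x)).
  by move=> /(edge2 _ _ _ eH xe)/(_ ne); rewrite cc.
have [] := conn _ _ eH e'H ee'; case=> s [Hs es e's].
  exact: C4_common_neighbours Hs (mem_cycle_edges es xe) (mem_cycle_edges e's x'e') ne cc.
have [y /andP[xy x'y]] : exists y, E x y && E x' y.
  exact: C6_common_neighbour Hs (mem_cycle_edges es xe) (mem_cycle_edges e's x'e') ne cc.
have x'f : x' \notin [set x; y].
  by rewrite !inE negb_or eq_sym ne; apply: contraNneq (c_proper xy) => <-; apply/eqP.
have ff' : [set x; y] != [set x'; y].
  by apply: contraNneq x'f => ->; rewrite !inE eqxx.
have [|s' [Hs' fs' f's']] := adjconn _ _ xy x'y ff'.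
  by apply/set0Pn; exists y; rewrite !inE !eqxx !orbT.
by apply: (C4_common_neighbours Hs' (mem_cycle_edges fs' _) (mem_cycle_edges f's' _) ne cc);
  rewrite !inE eqxx.
Qed.

End CommonNeighbours.

(** * The lift as a graph *)

Section LiftGraph.
Variables (I : finType) (Z : finZmodType) (W : {ffun I * I -> Z}).

(** The tagged pairs are numbered by [enum_rank], because the theorem asks for graphs on
    ordinals. *)
Let T := (bool * (I * Z))%type.
Notation V := 'I_#|{: T}|.

Definition lower (x : I * Z) : V := enum_rank (false, x).
Definition upper (y : I * Z) : V := enum_rank (true, y).
Definition side (u : V) : bool := (enum_val u).1.

Lemma side_lower x : side (lower x) = false. Proof. by rewrite /side enum_rankK. Qed.
Lemma side_upper y : side (upper y) = true. Proof. by rewrite /side enum_rankK. Qed.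

Lemma lower_inj : injective lower. Proof. by move=> x x' /enum_rank_inj[]. Qed.
Lemma upper_inj : injective upper. Proof. by move=> x x' /enum_rank_inj[]. Qed.

Lemma lower_upper x y : lower x != upper y.
Proof. by apply: contraFneq (side_lower x) => ->; rewrite side_upper. Qed.

Variant vertex_spec (u : V) : Prop :=
  | Lower x of u = lower x : vertex_spec u
  | Upper y of u = upper y : vertex_spec u.

Lemma vertexP u : vertex_spec u.
Proof.
rewrite -[u]enum_valK; case: (enum_val u) => -[] x; first exact: (Upper (y := x)).
exact: (Lower (x := x)).
Qed.

Definition edge (p : (I * Z) * (I * Z)) : {set V} := [set lower p.1; upper p.2].

Lemma lower_in_edge x p : (lower x \in edge p) = (x == p.1).
Proof. by rewrite !inE (inj_eq lower_inj) (negbTE (lower_upper _ _)) orbF. Qed.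

Lemma upper_in_edge y p : (upper y \in edge p) = (y == p.2).
Proof. by rewrite !inE (inj_eq upper_inj) eq_sym (negbTE (lower_upper _ _)). Qed.

Lemma edge_inj : injective edge.
Proof.
move=> p p' e; have /eqP e1 : p.1 == p'.1 by rewrite -lower_in_edge -e lower_in_edge.
have /eqP e2 : p.2 == p'.2 by rewrite -upper_in_edge -e upper_in_edge.
by rewrite [p]surjective_pairing e1 e2 -surjective_pairing.
Qed.

Definition lift_eset : {set {set V}} := edge @: [set p | adj W p.1 p.2].

Lemma lift_esetP e : e \in lift_eset -> (e \subset [set: V]) && (#|e| == 2).
Proof. by case/imsetP=> p _ ->; rewrite subsetT cards2 lower_upper. Qed.

Definition lift_graph : graph V := Graph lift_esetP.

Lemma side_proper u w : [set u; w] \in lift_eset -> side u != side w.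
Proof.
case/imsetP=> p _ e.
have /set2P h1 : lower p.1 \in [set u; w] by rewrite e lower_in_edge.
have /set2P h2 : upper p.2 \in [set u; w] by rewrite e upper_in_edge.
case: h1 h2 => <- [] h2; rewrite -?h2 ?side_lower ?side_upper //.
- by have /eqP := h2; rewrite eq_sym (negbTE (lower_upper _ _)).
- by have /eqP := h2; rewrite eq_sym (negbTE (lower_upper _ _)).
Qed.

Lemma lift_bipartite : bipartite lift_graph.
Proof. by exists [set u | side u] => u w /side_proper; rewrite !inE. Qed.

(** An edge is determined by its lower end and the index of its upper end: the equation in [adj]
    fixes the remaining label. *)
Lemma lift_esize : esize lift_graph = #|I| ^ 2 * #|Z|.
Proof.
rewrite /esize /= (card_imset _ edge_inj).
pose g (t : (I * Z) * I) : (I * Z) * (I * Z) := (t.1, (t.2, (W (t.1.1, t.2) - t.1.2)%R)).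
have injg : injective g by move=> [x j] [x' j'] [-> ->].
have -> : [set p | adj W p.1 p.2] = g @: setT.
  apply/setP => -[x [j b]]; rewrite inE /adj /=; apply/eqP/imsetP.
    by move=> e; exists (x, j); rewrite // /g /= -e addrC addKr.
  by case=> -[x' j'] _ [-> -> ->] /=; rewrite addrC subrK.
by rewrite (card_imset _ injg) cardsT !card_prod mulnAC.
Qed.

Section Subgraph.
Variable H : graph V.
Hypotheses (subH : subgraph H lift_graph) (strongH : internally_strongly_C6_connected H).

Let sub_eset e : e \in eset H -> exists2 p, e = edge p & adj W p.1 p.2.
Proof.
case/andP: subH => _ /subsetP s /s /imsetP[p]; rewrite inE => a ->.
by exists p.
Qed.

Let proper u w : [set u; w] \in eset H -> side u != side w.
Proof. by case/andP: subH => _ /subsetP s /s /side_proper. Qed.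

(** Only endpoints of edges of [H] are kept; connectivity says nothing about isolated vertices. *)
Definition lower_part := [set x | [exists e in eset H, lower x \in e]].
Definition upper_part := [set y | [exists e in eset H, upper y \in e]].

Lemma esize_le_edges : esize H <= #|edges W lower_part upper_part|.
Proof.
rewrite -(card_imset _ edge_inj); apply: subset_leq_card; apply/subsetP => e eH.
have [p ep a] := sub_eset eH; apply/imsetP; exists p => //.
rewrite !inE a andbT; apply/andP; split; apply/existsP; exists e.
  by rewrite eH ep lower_in_edge eqxx.
by rewrite eH ep upper_in_edge eqxx.
Qed.

Lemma linked_lower : linked W lower_part upper_part.
Proof.
move=> x x'; rewrite !inE => /existsP[e /andP[eH xe]] /existsP[e' /andP[e'H x'e']] ne.
have [//||u [u' [uu' h1 h2]]] :=
  strongly_connected_common_neighbours proper strongH eH e'H xe x'e'.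
- by rewrite (inj_eq lower_inj).
- by rewrite !side_lower.
have nb z w : [set lower z; w] \in eset H -> exists2 y, w = upper y & adj W z y /\ y \in upper_part.
  move=> zH; case: (vertexP w) => y ew; first by have := proper zH; rewrite ew !side_lower.
  exists y => //; split; last first.
    by rewrite inE; apply/existsP; exists [set lower z; w]; rewrite zH ew !inE eqxx orbT.
  have [p ep a] := sub_eset zH; rewrite ew in ep.
  by have := edge_inj (ep : edge (z, y) = edge p) => pp; move: a; rewrite -pp.
case/andP: h1 => /nb[y ey [a1 yU]] /nb[y1 ey1 [a2 _]].
case/andP: h2 => /nb[y' ey' [a3 y'U]] /nb[y2 ey2 [a4 _]].
have e1 : y1 = y by apply: upper_inj; rewrite -ey -ey1.
have e2 : y2 = y' by apply: upper_inj; rewrite -ey' -ey2.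
move: a2 a4; rewrite e1 e2 => a2 a4; exists y, y'; rewrite a1 a2 a3 a4; split=> //.
by apply: contraNneq uu' => yy; rewrite ey ey' yy.
Qed.

Lemma linked_upper : linked (transpose W) upper_part lower_part.
Proof.
move=> x x'; rewrite !inE => /existsP[e /andP[eH xe]] /existsP[e' /andP[e'H x'e']] ne.
have [//||u [u' [uu' h1 h2]]] :=
  strongly_connected_common_neighbours proper strongH eH e'H xe x'e'.
- by rewrite (inj_eq upper_inj).
- by rewrite !side_upper.
have nb z w : [set upper z; w] \in eset H ->
    exists2 y, w = lower y & adj (transpose W) z y /\ y \in lower_part.
  move=> zH; case: (vertexP w) => y ew; last by have := proper zH; rewrite ew !side_upper.
  exists y => //; split; last first.
    by rewrite inE; apply/existsP; exists [set upper z; w]; rewrite zH ew !inE eqxx orbT.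
  have [p ep a] := sub_eset zH; rewrite ew setUC in ep; rewrite adj_transpose.
  by have := edge_inj (ep : edge (y, z) = edge p) => pp; move: a; rewrite -pp.
case/andP: h1 => /nb[y ey [a1 yU]] /nb[y1 ey1 [a2 _]].
case/andP: h2 => /nb[y' ey' [a3 y'U]] /nb[y2 ey2 [a4 _]].
have e1 : y1 = y by apply: lower_inj; rewrite -ey -ey1.
have e2 : y2 = y' by apply: lower_inj; rewrite -ey' -ey2.
move: a2 a4; rewrite e1 e2 => a2 a4; exists y, y'; rewrite a1 a2 a3 a4; split=> //.
by apply: contraNneq uu' => yy; rewrite ey ey' yy.
Qed.

End Subgraph.

End LiftGraph.

Lemma exists_lift_graph (I : finType) (Z : finZmodType) (h v l : nat) :
  #|Z| = 2 ^ h -> #|I| = 2 ^ v -> 64 * (l + 5) ^ 2 <= h ->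
  32 * 64 * 2 ^ v <= (2 ^ h) ^ 2 -> 36 * h ^ 2 <= 2 ^ l ->
  h ^ 4 * 4 ^ l <= 2 ^ v -> 16 * (2 ^ h * h ^ 2) <= 2 ^ v ->
  exists G : graph 'I_#|{: bool * (I * Z)}|,
    [/\ vset G = setT, bipartite G, esize G = (2 ^ v) ^ 2 * 2 ^ h
      & forall H, subgraph H G -> internally_strongly_C6_connected H ->
          esize H * (2 ^ h * h ^ 2) <= 9 * (2 ^ v) ^ 2].
Proof.
move=> cZ cI lh vh hl hv hq.
have h0 : 0 < h by apply: leq_trans lh; rewrite muln_gt0 expn_gt0 addnS.
have vh2 : v <= 2 * h.
  rewrite -(@leq_exp2l 2) // [2 * h]mulnC expnM; apply: leq_trans vh.
  by rewrite leq_pmull.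
have lv : 2 ^ l * (4 * h + 5) <= 2 ^ v.
  apply: leq_trans hv; rewrite mulnC; apply: leq_mul; last first.
    by rewrite -[4]/(2 ^ 2) -expnM leq_exp2l // mulSn leq_addr.
  have h4 : 4 <= h by move: lh; rewrite -mulnn; clear; nia.
  have h43 : 4 ^ 3 <= h ^ 3 by rewrite leq_exp2r.
  have := leq_mul h43 (leqnn h); rewrite -expnSr.
  by move: h0; clear; lia.
have [W [sW gW gW']] := exists_sparse cZ cI h0 vh2 lv.
exists (lift_graph W); split=> //; first exact: lift_bipartite.
  by rewrite lift_esize cZ cI.
move=> H subH sH; apply: leq_trans (leq_mul (esize_le_edges subH) (leqnn _)) _.
exact: (linked_edges_le cI lh vh hl hv sW gW gW' (linked_lower subH sH) (linked_upper subH sH)).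
Qed.

(** * Elementary conditions on the exponents *)

Import Order.TTheory Num.Theory.
Local Open Scope ring_scope.

(** Provides [36 * h ^ 2 <= 2 ^ l] for $h = 64(l+5)^2$ and large [l]. With $m = \lfloor l/8
    \rfloor$, the left side is at most $2^{5m+16}$, and $m \ge 6$. *)
Lemma quartic_le_exp K : exists l0, forall l, (l0 <= l)%N -> (K * (l + 5) ^ 4 <= 2 ^ l)%N.
Proof.
exists (8 * (K + 6))%N => l hl; pose m := (l %/ 8)%N.
have mK : (K + 6 <= m)%N by rewrite leq_divRL // mulnC.
have l5 : (l + 5 <= 2 ^ 4 * 2 ^ m)%N.
  have := ltn_ceil l (isT : (0 < 8)%N); rewrite -/m => lt.
  apply: (@leq_trans (2 ^ 4 * m)%N); last by rewrite leq_pmul2l // ltnW // ltn_expl.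
  by rewrite -[(2 ^ 4)%N]/16%N; lia.
apply: (@leq_trans (2 ^ m * (2 ^ 4 * 2 ^ m) ^ 4)%N).
  apply: leq_mul; last by rewrite leq_exp2r.
  by rewrite (leq_trans (ltnW (ltn_expl K (isT : (1 < 2)%N)))) // leq_exp2l //; lia.
rewrite -expnD -expnM -expnD leq_exp2l //.
by have := leq_trunc_div l 8; rewrite -/m; lia.
Qed.

(** The shift by [11] absorbs $32 \cdot 64 = 2^{11}$, leaving $w \le h$ for the first condition; $w
    \ge l + 15$ leaves room for $16h^2 \le 2^{l+4}$ in the last. *)
Lemma exponent_conditions l h w :
  (64 * (l + 5) ^ 2 <= h)%N -> (l + 15 <= w <= h)%N -> (36 * h ^ 2 <= 2 ^ l)%N ->
  let v := (h + w - 11)%N in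
  [/\ 32 * 64 * 2 ^ v <= (2 ^ h) ^ 2, h ^ 4 * 4 ^ l <= 2 ^ v
    & 16 * (2 ^ h * h ^ 2) <= 2 ^ v]%N.
Proof.
move=> lh /andP[lw wh] hp v.
have hl : (h ^ 2 <= 2 ^ l)%N by apply: leq_trans hp; rewrite leq_pmull.
have h4 : (4 * l + 11 <= h)%N by apply: leq_trans lh; rewrite -mulnn; clear; lia.
split=> //.
- rewrite -[32%N]/(2 ^ 5)%N -[64%N]/(2 ^ 6)%N -!expnD -expnM leq_exp2l // /v; lia.
- apply: (@leq_trans (2 ^ (4 * l))%N); last by rewrite leq_exp2l // /v; lia.
  have -> : (h ^ 4 * 4 ^ l = (h ^ 2) ^ 2 * 2 ^ (2 * l))%N by rewrite -expnM [(2 ^ (2 * _))%N]expnM.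
  apply: (@leq_trans ((2 ^ l) ^ 2 * 2 ^ (2 * l))%N); first by rewrite leq_mul2r leq_sqr hl orbT.
  by rewrite -expnM -expnD leq_exp2l //; lia.
- apply: (@leq_trans (2 ^ 4 * (2 ^ h * 2 ^ l))%N); first by rewrite leq_mul2l leq_mul2l hl !orbT.
  rewrite -!expnD leq_exp2l // /v; lia.
Qed.

(** * Choice of the parameters *)

(* The group has order [2 ^ zbits l], and the index set has
   [2 ^ (zbits l + xbits l - 11)] elements, so that [2 ^ 11 * #|I| <= #|Z| ^ 2]. *)
Definition zbits l := (64 * (l + 5) ^ 2)%N.

Lemma zbits_ge l : (11 <= zbits l)%N.
Proof. by rewrite /zbits -mulnn; lia. Qed.

Section Real.
Variables (R : realType) (beta : R).
Hypothesis hbeta : 1 / 3 <= beta < 1 / 2.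

Let beta_gt0 : 0 < beta. Proof. by case/andP: hbeta => ? ?; lra. Qed.

(** Solves $\beta(2 + \theta) = 1$: if $w \approx \theta h$, then $n = 2^{2h+w-10}$ has $n^\beta$ of
    order $2^h$. The range of [beta] is precisely $0 < \theta \le 1$. *)
Let theta := beta^-1 - 2.

Let theta_beta : beta * theta = 1 - 2 * beta.
Proof. by rewrite /theta; field; rewrite gt_eqF. Qed.

Let theta_gt0 : 0 < theta.
Proof. by rewrite -(pmulr_rgt0 _ beta_gt0) theta_beta; case/andP: hbeta => ? ?; lra. Qed.

Let theta_le1 : theta <= 1.
Proof. by rewrite -(ler_pM2l beta_gt0) theta_beta; case/andP: hbeta => ? ?; lra. Qed.

Definition xbits l := Num.truncn (theta * (zbits l)%:R).

Lemma xbits_bounds l : (xbits l)%:R <= theta * (zbits l)%:R < (xbits l)%:R + 1.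
Proof.
by rewrite natr1; apply: truncn_itv; rewrite mulr_ge0 ?ler0n // ltW.
Qed.

Lemma xbits_le l : (xbits l <= zbits l)%N.
Proof.
have /andP[h1 _] := xbits_bounds l; rewrite -(ler_nat R); apply: le_trans h1 _.
by rewrite ler_piMl ?ler0n.
Qed.

Lemma xbits_homo l l' : (zbits l < zbits l')%N -> (xbits l <= xbits l')%N.
Proof.
move=> ll'; apply: le_truncn.
by rewrite ler_pM2l // ler_nat ltnW.
Qed.

(** As [zbits l] is quadratic in [l], any fixed $\theta > 0$ suffices: once $\theta(l+5) \ge 1$ the
    product is at least $64(l+5)$. *)
Lemma xbits_large : exists l0, forall l, (l0 <= l)%N -> (l + 15 <= xbits l)%N.
Proof.
exists (Num.truncn theta^-1).+1 => l hl.
rewrite truncn_ge_nat; last by rewrite mulr_ge0 ?ler0n // ltW.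
have t1 : 1 <= theta * (l + 5)%:R.
  rewrite mulrC -ler_pdivrMr // mul1r ltW //.
  have t0 : 0 <= theta^-1 by rewrite invr_ge0 ltW.
  have /andP[_ lt] := truncn_itv t0; apply: lt_le_trans lt _.
  by rewrite ler_nat (leq_trans hl) ?leq_addr.
have -> : theta * (zbits l)%:R = (theta * (l + 5)%:R) * (64 * (l + 5))%:R.
  by rewrite /zbits -mulnn !natrM; ring.
apply: le_trans (_ : (64 * (l + 5))%:R <= _); first by rewrite ler_nat; lia.
by rewrite ler_peMl ?ler0n.
Qed.

(** The exponent $\beta(2h+w-10)$ lies between $h - 11\beta$ and $h - 10\beta$; since $11\beta < 6$,
    the loss is at most $2^6 = 64$. *)
Lemma powR_vertices (h w : nat) : (11 <= h)%N ->
  w%:R <= theta * h%:R < w%:R + 1 ->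
  let n := (2 ^ (h + w - 11 + h + 1))%N in
  n%:R `^ beta <= (2 ^ h)%:R :> R /\ (2 ^ h)%:R <= 64 * n%:R `^ beta :> R.
Proof.
move=> h11 /andP[w1 w2] n.
have e : ((h + w - 11 + h + 1)%:R = 2 * h%:R + w%:R - 10 :> R).
  have -> : (h + w - 11 + h + 1 = 2 * h + w - 10)%N by lia.
  rewrite natrB; first by rewrite natrD natrM.
  by clear -h11; lia.
have bl : beta * (theta * h%:R) = (1 - 2 * beta) * h%:R by rewrite mulrA theta_beta.
have b1 := ler_wpM2l (ltW beta_gt0) w1; have b2 := ler_wpM2l (ltW beta_gt0) (ltW w2).
rewrite bl in b1 b2; rewrite mulrDr mulr1 in b2.
have two (k : nat) : (2 ^ k)%:R = 2 `^ k%:R :> R by rewrite powR_mulrn // natrX.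
have -> : n%:R `^ beta = 2 `^ ((h + w - 11 + h + 1)%:R * beta) :> R.
  by rewrite /n two -powRrM.
rewrite (_ : 64 = 2 `^ 6%:R :> R); last by rewrite powR_mulrn // -natrX.
rewrite two -powRD; last by rewrite (_ : (2 : R) != 0) ?implybT // pnatr_eq0.
rewrite e; move: hbeta => /andP[hb1 hb2].
by split; apply: ler_powR; rewrite ?ler1n //; lra.
Qed.

End Real.

(** * Asymptotic bounds and the infinite sequence *)

Definition extremal (R : realType) (beta c1 c2 C : R) (n : nat) (G : graph 'I_n) : Prop :=
  [/\ vset G = [set: 'I_n],
      bipartite G,
      c1 * n%:R `^ (2 - beta) <= (esize G)%:R
        /\ (esize G)%:R <= c2 * n%:R `^ (2 - beta),
      c1 * n%:R `^ (- beta) <= density R G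
        /\ density R G <= c2 * n%:R `^ (- beta)
    & forall H : graph 'I_n,
        subgraph H G -> internally_strongly_C6_connected H ->
        (esize H)%:R <= C * (density R G ^+ 3 * n%:R ^+ 2 / ln n%:R ^+ 2)
        /\ (esize H)%:R <= C * (n%:R `^ (2 - 3 * beta) / ln n%:R ^+ 2)].

(** Here $n = 2Nq$ and the density is exactly $1/(4q)$, so $q \le 64n^\beta$ gives [1 / 256].
    Moreover $\rho^3 n^2 = N^2/(16q)$ and $\ln n \le 3h$, whence $1296 = 9 \cdot 16 \cdot 9$. *)
Lemma graph_estimates (R : realType) (beta : R) (n h v : nat) (G : graph 'I_n) :
  (0 < h)%N -> (v + h + 1 <= 3 * h)%N -> n = (2 ^ (v + h + 1))%N ->
  n%:R `^ beta <= (2 ^ h)%:R -> (2 ^ h)%:R <= 64 * n%:R `^ beta ->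
  vset G = setT -> bipartite G -> esize G = ((2 ^ v) ^ 2 * 2 ^ h)%N ->
  (forall H, subgraph H G -> internally_strongly_C6_connected H ->
     esize H * (2 ^ h * h ^ 2) <= 9 * (2 ^ v) ^ 2)%N ->
  extremal beta (1 / 256) 1 1296 G.
Proof.
move=> h0 vh nE x1 x2 vG bG eG bound.
pose q : R := (2 ^ h)%:R; pose N : R := (2 ^ v)%:R; pose x : R := n%:R `^ beta.
have q0 : 0 < q by rewrite ltr0n expn_gt0.
have N0 : 0 < N by rewrite ltr0n expn_gt0.
have qn : q != 0 := lt0r_neq0 q0.
have Nn : N != 0 := lt0r_neq0 N0.
have nR : n%:R = 2 * (N * q) :> R.
  by rewrite nE !expnD expn1 !natrM mulrC mulrA.
have n0 : 0 < n%:R :> R by rewrite nR !mulr_gt0.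
have x0 : 0 < x by rewrite powR_gt0.
have eR : (esize G)%:R = N ^+ 2 * q by rewrite eG natrM natrX.
have dE : density R G = (4 * q)^-1.
  rewrite /density vG cardsT card_ord eR nR; field.
  by rewrite ?qn ?Nn.
have nb : n%:R `^ (- beta) = x^-1 :> R by rewrite powRN.
have n2 : n%:R `^ (2 - beta) = n%:R ^+ 2 * x^-1 :> R.
  rewrite powRB; last by rewrite (gt_eqF n0) implybT.
  by rewrite powR_mulrn // ltW.
have n3 : n%:R `^ (2 - 3 * beta) = n%:R ^+ 2 * x^-1 ^+ 3 :> R.
  rewrite powRB; last by rewrite (gt_eqF n0) implybT.
  have -> : n%:R `^ (3 * beta) = x ^+ 3 by rewrite mulrC powRrM -/x powR_mulrn // ltW.
  by rewrite powR_mulrn ?exprVn // ltW.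
have d1 : 1 / 256 * x^-1 <= density R G.
  rewrite dE div1r -invfM lef_pV2 ?posrE ?mulr_gt0 //; rewrite -/q -/x in x1 x2; lra.
have d2 : density R G <= x^-1.
  rewrite dE lef_pV2 ?posrE ?mulr_gt0 //; rewrite -/q -/x in x1 x2; lra.
have ed : (esize G)%:R = n%:R ^+ 2 * density R G.
  by rewrite eR dE nR; field; rewrite ?qn ?Nn.
have n20 : 0 < n%:R ^+ 2 :> R by rewrite exprn_gt0.
have d0 : 0 < density R G by rewrite dE invr_gt0 mulr_gt0.
have pos : 0 < density R G ^+ 3 * n%:R ^+ 2.
  by apply: mulr_gt0; rewrite // exprn_gt0.
rewrite /extremal n2 nb; split.
- exact: vG.
- exact: bG.
- split; first by rewrite ed mulrCA (ler_pM2l n20).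
  by rewrite ed [1 * _]mul1r (ler_pM2l n20).
- by rewrite [1 * x^-1]mul1r.
move=> H sH cH; have hb := bound H sH cH.
have ln0 : 0 < ln (n%:R : R).
  by apply: ln_gt0; rewrite ltr1n nE -{1}(expn0 2) ltn_exp2l // addn1.
have lnle : ln (n%:R : R) <= 3 * h%:R.
  rewrite nE natrX lnXn // -[ln _ *+ _]mulr_natl -natrM; apply: le_trans (_ : (v + h + 1)%:R <= _).
    rewrite ler_piMr ?ler0n //.
    have := @le_ln1Dx R 1; rewrite (_ : 1 + 1 = 2%:R) //; apply.
    by rewrite (lt_trans _ ltr01) // oppr_lt0.
  by rewrite ler_nat.
have key : (esize H)%:R <= 1296 * (density R G ^+ 3 * n%:R ^+ 2 / ln n%:R ^+ 2).
  have hh0 : 0 < h%:R :> R by rewrite ltr0n.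
  apply: (@le_trans _ _ (9 * N ^+ 2 / (q * h%:R ^+ 2))).
    by rewrite ler_pdivlMr ?mulr_gt0 ?exprn_gt0 // -!natrX -!natrM ler_nat.
  have -> : 9 * N ^+ 2 / (q * h%:R ^+ 2) = 1296 * (density R G ^+ 3 * n%:R ^+ 2 / (3 * h%:R) ^+ 2).
    by rewrite dE nR; field; rewrite ?qn ?Nn ?(lt0r_neq0 hh0).
  rewrite ler_pM2l // (ler_pM2l pos).
  by rewrite lef_pV2 ?posrE ?exprn_gt0 ?mulr_gt0 // lerXn2r ?nnegrE ?mulr_ge0 ?ler0n // ltW.
split=> //; apply: le_trans key _.
rewrite ler_pM2l // n3 ler_pM2r ?invr_gt0 ?exprn_gt0 // mulrC ler_pM2l //.
by rewrite lerXn2r ?nnegrE ?invr_ge0 // ltW.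
Qed.

(** Row vectors over the field with two elements provide the abelian group of order $2^h$. *)
Lemma card_vertices h v :
  #|{: bool * ('I_(2 ^ v) * 'rV['F_2]_h)}| = (2 ^ (v + h + 1))%N.
Proof.
rewrite !card_prod card_bool card_ord card_mx card_Fp // mul1n !expnD expn1.
by rewrite mulnC.
Qed.

Lemma exists_extremal (R : realType) (beta : R) (n l h w : nat) :
  1 / 3 <= beta < 1 / 2 -> h = (64 * (l + 5) ^ 2)%N ->
  w%:R <= (beta^-1 - 2) * h%:R < w%:R + 1 ->
  (l + 15 <= w <= h)%N -> (36 * h ^ 2 <= 2 ^ l)%N ->
  n = #|{: bool * ('I_(2 ^ (h + w - 11)) * 'rV['F_2]_h)}| ->
  exists G : graph 'I_n, extremal beta (1 / 256) 1 1296 G.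
Proof.
move=> hbeta hE wE lw hl ->.
have h11 : (11 <= h)%N by rewrite hE zbits_ge.
have lh : (64 * (l + 5) ^ 2 <= h)%N by rewrite hE.
have [c1 c2 c3] := exponent_conditions lh lw hl.
have cZ : #|{: 'rV['F_2]_h}| = (2 ^ h)%N by rewrite card_mx card_Fp // mul1n.
have cI : #|{: 'I_(2 ^ (h + w - 11))}| = (2 ^ (h + w - 11))%N by rewrite card_ord.
have [G [g1 g2 g3 g4]] := exists_lift_graph cZ cI lh c1 hl c2 c3.
have [x1 x2] := powR_vertices hbeta h11 wE.
exists G; apply: (graph_estimates (h := h) (v := (h + w - 11)%N)) => //.
- by rewrite (leq_trans _ h11).
- by case/andP: lw => _; lia.
- exact: card_vertices.
- by rewrite card_vertices.
- by rewrite card_vertices.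
Qed.

(** Forcing $c\rho^3n^2$ edges against the upper bound would give $(\ln n)^2 \le C/c$, which fails
    for large [n]. *)
Lemma no_uniform_constant (R : realType) (beta c1 c2 C : R)
    (n : nat -> nat) (G : forall k, graph 'I_(n k)) :
  0 < c1 -> 0 < C -> (forall k, 2 ^ k <= n k)%N ->
  (forall k, extremal beta c1 c2 C (G k)) ->
  ~ (exists c : R, 0 < c /\
      exists n0 : nat, forall n : nat, (n0 <= n)%N ->
        forall G : graph 'I_n,
          vset G = [set: 'I_n] -> bipartite G ->
          c1 * n%:R `^ (- beta) <= density R G ->
          density R G <= c2 * n%:R `^ (- beta) ->
          exists H : graph 'I_n,
            [/\ subgraph H G, internally_strongly_C6_connected H
              & c * (density R G ^+ 3 * n%:R ^+ 2) <= (esize H)%:R]).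
Proof.
move=> c10 C0 ngrow ext [c [c0 [n0 Hn0]]].
have ln2 : 0 < ln (2 : R) by apply: ln_gt0; rewrite ltr1n.
pose t := C / c / ln 2 ^+ 2.
have t0 : 0 <= t by rewrite !divr_ge0 ?exprn_ge0 // ltW.
(* Beyond both [n0] and $C/(c \ln^2 2)$: as $n_k \ge 2^k$ and $k^2 \ge k$, this gives $(\ln n_k)^2 >
   C/c$. *)
pose k := (n0 + (Num.truncn t).+1)%N.
have [vG bG _ [d1 d2] Hb] := ext k.
have [|H [sH cH low]] := Hn0 (n k) _ (G k) vG bG d1 d2.
  by rewrite (leq_trans _ (ngrow k)) // (leq_trans _ (ltnW (ltn_expl _ _))) // leq_addr.
have [up _] := Hb H sH cH; have {low up} := le_trans low up.
have nk0 : 0 < (n k)%:R :> R by rewrite ltr0n (leq_trans _ (ngrow k)) ?expn_gt0.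
have dpos : 0 < density R (G k) by apply: lt_le_trans d1; rewrite mulr_gt0 ?powR_gt0.
have pos : 0 < density R (G k) ^+ 3 * (n k)%:R ^+ 2.
  by apply: mulr_gt0; rewrite exprn_gt0.
have k1 : (1 <= k)%N by rewrite /k addnS.
have lnk : k%:R * ln 2 <= ln (n k)%:R :> R.
  rewrite mulr_natl -lnXn // ler_ln ?posrE ?exprn_gt0 // -natrX ler_nat; exact: ngrow.
have lk0 : 0 < k%:R * ln (2 : R) by rewrite mulr_gt0 // ltr0n.
have L0 : 0 < ln (n k)%:R ^+ 2 :> R by rewrite exprn_gt0 // (lt_le_trans lk0 lnk).
have tk : t < k%:R.
  have /andP[_ lt] := truncn_itv t0; apply: lt_le_trans lt _.
  by rewrite ler_nat leq_addl.
have small : C / ln (n k)%:R ^+ 2 < c.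
  move: tk; rewrite /t ltr_pdivrMr ?exprn_gt0 // ltr_pdivrMr // ltr_pdivrMr // => lt.
  apply: lt_le_trans lt _; rewrite [c * _]mulrC ler_pM2r //.
  apply: le_trans (_ : (k%:R * ln 2) ^+ 2 <= _); last first.
    by rewrite lerXn2r ?nnegrE // ?(ltW lk0) // (le_trans (ltW lk0)).
  by rewrite exprMn ler_pM2r ?exprn_gt0 // expr2 ler_peMr ?ler0n // ler1n.
by rewrite [X in _ <= X]mulrCA [X in _ <= X]mulrC ler_pM2r // leNgt small.
Qed.

Theorem theorem1p4 (R : realType) (beta : R) (hbeta : 1 / 3 <= beta < 1 / 2) :
  exists c1 c2 C : R,
    [/\ 0 < c1, 0 < c2, 0 < C,
      exists (n : nat -> nat) (G : forall k : nat, graph 'I_(n k)),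
        {homo n : i j / (i < j)%N} /\
        forall k : nat,
          [/\ vset (G k) = [set: 'I_(n k)],
              bipartite (G k),
              c1 * (n k)%:R `^ (2 - beta) <= (esize (G k))%:R
                /\ (esize (G k))%:R <= c2 * (n k)%:R `^ (2 - beta),
              c1 * (n k)%:R `^ (- beta) <= density R (G k)
                /\ density R (G k) <= c2 * (n k)%:R `^ (- beta)
            & forall H : graph 'I_(n k),
                subgraph H (G k) -> internally_strongly_C6_connected H ->
                (esize H)%:R <=
                  C * (density R (G k) ^+ 3 * (n k)%:R ^+ 2 / ln (n k)%:R ^+ 2)
                /\
                (esize H)%:R <=
                  C * ((n k)%:R `^ (2 - 3 * beta) / ln (n k)%:R ^+ 2)]
    & ~ (exists c : R, 0 < c /\
          exists n0 : nat, forall n : nat, (n0 <= n)%N ->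
            forall G : graph 'I_n,
              vset G = [set: 'I_n] -> bipartite G ->
              c1 * n%:R `^ (- beta) <= density R G ->
              density R G <= c2 * n%:R `^ (- beta) ->
              exists H : graph 'I_n,
                [/\ subgraph H G, internally_strongly_C6_connected H
                  & c * (density R G ^+ 3 * n%:R ^+ 2) <= (esize H)%:R])].
Proof.
have [l1 Pl1] := xbits_large hbeta; have [l2 Pl2] := quartic_le_exp (36 * 64 ^ 2).
(* Starting at [l1 + l2] makes both eventual conditions hold for every [k]. *)
pose l k := (l1 + l2 + k)%N; pose h k := zbits (l k); pose w k := xbits beta (l k).
pose n k := #|{: bool * ('I_(2 ^ (h k + w k - 11)) * 'rV['F_2]_(h k))}|.
have nE k : n k = (2 ^ (h k + w k - 11 + h k + 1))%N by rewrite /n card_vertices.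
have h11 k : (11 <= h k)%N by exact: zbits_ge.
have h_lt i j : (i < j -> h i < h j)%N.
  by move=> ij; rewrite /h /zbits ltn_pmul2l // ltn_sqr /l; lia.
have w_le i j : (i < j -> w i <= w j)%N.
  by move=> /h_lt ij; apply: xbits_homo.
have ext k : exists G : graph 'I_(n k), extremal beta (1 / 256) 1 1296 G.
  apply: (@exists_extremal _ beta (n k) (l k) (h k) (w k)) => //.
  - exact: xbits_bounds.
  - by rewrite Pl1 ?xbits_le // /l -addnA leq_addr.
  - have := Pl2 (l k); rewrite /h /zbits expnMn -expnM mulnA; apply.
    by rewrite /l addnAC leq_addl.
(* One graph for each [k], selected by indefinite description. *)
pose G k := projT1 (boolp.cid (ext k)).
have extG k : extremal beta (1 / 256) 1 1296 (G k) := projT2 (boolp.cid (ext k)).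
have c0 : 0 < 1 / 256 :> R by rewrite divr_gt0.
have C0 : 0 < 1296 :> R by [].
have grow k : (2 ^ k <= n k)%N.
  rewrite nE leq_exp2l //; elim: k => // k IH.
  have := h_lt _ _ (ltnSn k); have := w_le _ _ (ltnSn k); have := h11 k; lia.
exists (1 / 256), 1, 1296; split=> //.
  exists n, G; split=> // i j ij; rewrite !nE ltn_exp2l //.
  have := h_lt _ _ ij; have := w_le _ _ ij; have := h11 i; lia.
exact: (no_uniform_constant c0 C0 grow extG).
Qed.
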